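(* For each integer $n\ge 1$ let $H_n$ be the $n$-dimensional Hamming cube equipped with the uniform weight function. There exists a universal constant $c>0$ such that for every $n\ge 1$ and every metric space $X$ with at least two points, $$\lambda(H_n,X)\ge\frac{c}{n^2}.$$ Moreover, this estimate is asymptotically sharp as an estimate for arbitrary metric spaces: there exist a universal constant $C>0$ and, for each $n\geq 1$, a metric space $X_n$ with at least two points, such that $\lambda(H_n,X_n)\le \frac{C}{n^2}$ for all $n\ge 1$.
   Context: The $n$-dimensional Hamming cube $H_n$ is the graph with vertex set $\{0,1\}^n$ in which two vertices are adjacent if and only if they differ in exactly one coordinate. For a finite, simple, connected graph $G=(V,E)$ with at least two vertices, let $\vec{E}=\{(x,y)\in V\times V : \{x,y\}\in E\}$. The uniform weight function on $G$ is $m:V\times V\to[0,\infty)$ with $m(x,y)=1$ if $(x,y)\in\vec{E}$ and $m(x,y)=0$ otherwise. Write $m(x)=\sum_{y\in V}m(x,y)$ and $m(\emptyset)=\sum_{x\in V}m(x)$. For a metric space $(X,d_X)$ with at least two points, the nonlinear spectral gap $\lambda(G,X)$ is the reciprocal of the smallest constant $C>0$ such that for every map $f:V\to X$ $$\frac{1}{m(\emptyset)}\sum_{x,y\in V}m(x)m(y)\,d_X(f(x),f(y))^2\le C\sum_{x,y\in V}m(x,y)\,d_X(f(x),f(y))^2 .$$ *)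

(* Defs.v *)
From HB Require Import structures.
From mathcomp Require Import all_boot all_order all_algebra.
From mathcomp Require Import all_classical all_reals all_analysis.

Set Implicit Arguments.
Unset Strict Implicit.
Unset Printing Implicit Defensive.
Import Order.TTheory GRing.Theory Num.Theory.

Local Open Scope classical_set_scope.
Local Open Scope ring_scope.

Section weights.
Context {R : realType} {V : finType}.
Implicit Types (e : rel V) (m : V -> V -> R).

Definition uniform_weight e : V -> V -> R := fun x y => (e x y)%:R.

Definition weight_vertex m (x : V) : R := \sum_(y : V) m x y.

Definition weight_total m : R := \sum_(x : V) weight_vertex m x.

Definition poincare m (X : metricType R) (C : R) : Prop :=
  forall f : V -> X,
    (weight_total m)^-1 *
      (\sum_(x : V) \sum_(y : V)
         weight_vertex m x * weight_vertex m y * mdist (f x) (f y) ^+ 2)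
    <= C * \sum_(x : V) \sum_(y : V) m x y * mdist (f x) (f y) ^+ 2.

(* The smallest admissible constant is rendered as an infimum; it is attained,
   see [poincare_inf]. When no constant is admissible (impossible for a finite
   connected graph), [inf set0 = 0] and the gap is [0^-1 = 0]. *)
Definition spectral_gap m (X : metricType R) : R :=
  (inf [set C : R | 0 < C /\ poincare m X C])^-1.

Lemma poincare_inf m (X : metricType R) : (forall x y, 0 <= m x y) ->
  [set C : R | 0 < C /\ poincare m X C] !=set0 ->
  poincare m X (inf [set C : R | 0 < C /\ poincare m X C]).
Proof.
move=> m0 S0 f; set L := (X in X <= _); set D := (X in _ <= _ * X).
have D0 : 0 <= D.
  by apply: sumr_ge0 => x _; apply: sumr_ge0 => y _; rewrite mulr_ge0 ?sqr_ge0.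
have [D_eq0|D_neq0] := eqVneq D 0.
  by case: S0 => C [_ /(_ f)]; rewrite -/L -/D D_eq0 !mulr0.
have D_gt0 : 0 < D by rewrite lt_neqAle eq_sym D_neq0.
rewrite -ler_pdivrMr//; apply: lb_le_inf => // C [_ /(_ f)].
by rewrite ler_pdivrMr.
Qed.

End weights.

Definition hamming_cube (n : nat) : rel {ffun 'I_n -> bool} :=
  fun x y => #|[set i | x i != y i]%SET| == 1%N.

Arguments hamming_cube : clear implicits.

Lemma hamming_cube_sym n : symmetric (hamming_cube n).
Proof.
move=> x y; rewrite /hamming_cube; congr (_ == _); apply: eq_card => i.
by rewrite !inE eq_sym.
Qed.

Lemma hamming_cube_irr n : irreflexive (hamming_cube n).
Proof.
move=> x; rewrite /hamming_cube (_ : [set _ | _]%SET = finset.set0) ?cards0//.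
by apply/setP => i; rewrite !inE eqxx.
Qed.

Lemma hamming_cube_connected n x y : connect (hamming_cube n) x y.
Proof.
have [k] := ubnP #|[set i | x i != y i]%SET|.
elim: k x => // k IHk x; rewrite ltnS => xyk.
have [xy0|/set0Pn[i xyi]] := eqVneq [set i | x i != y i]%SET finset.set0.
  suff -> : x = y by exact: connect0.
  by apply/ffunP => i; move/setP/(_ i): xy0; rewrite !inE => /negbFE/eqP.
pose z := [ffun j => if j == i then y i else x j].
have xz : hamming_cube n x z.
  rewrite /hamming_cube (_ : [set _ | _]%SET = [set i]%SET) ?cards1//.
  apply/setP => j; rewrite !inE ffunE; case: (j =P i) => [->|_]; last by rewrite eqxx.
  by move: xyi; rewrite inE.
apply: connect_trans (connect1 xz) (IHk _ _).
suff zyE : [set j | z j != y j]%SET = ([set j | x j != y j] :\ i)%SET.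
  by rewrite zyE; move: xyk; rewrite (cardsD1 i) xyi.
apply/setP => j; rewrite !inE ffunE; case: (j =P i) => [->|_] //=.
by rewrite eqxx.
Qed.

Lemma card_hamming_cube n : #|{ffun 'I_n -> bool}| = (2 ^ n)%N.
Proof. by rewrite card_ffun card_bool card_ord. Qed.

(* Main.v *)
(* If e_1, ..., e_n generate the cube, walking from x to x + z along the
   coordinates of z gives, by the triangle inequality and Cauchy-Schwarz,
   d(f x, f (x + z))^2 <= n * sum of the squared edge lengths met on the way.
   Summing over x (each step is a translation of the cube) and then over z
   shows that the constant n^2 is admissible for every metric space.
   Conversely, test the inequality on the identity of the cube with its Hamming
   metric h: all edges have length 1, while h(x, y) + h(x, ~y) = n forces the
   mean of h^2 to be at least n^2 / 4, so no constant below n^2 / 4 works. *)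
Require Import Defs.
From HB Require Import structures.
From mathcomp Require Import all_boot all_order all_algebra ring lra.
From mathcomp Require Import all_classical all_reals all_analysis.

Set Implicit Arguments.
Unset Strict Implicit.
Unset Printing Implicit Defensive.
Import Order.TTheory GRing.Theory Num.Theory.

Local Open Scope ring_scope.

(** * Cauchy-Schwarz and the triangle inequality along a walk *)

Lemma sqr_sum_le (R : realFieldType) (n : nat) (a : 'I_n -> R) :
  (\sum_i a i) ^+ 2 <= n%:R * \sum_i a i ^+ 2.
Proof.
(* Both sides become double sums, compared termwise by [a i * a j <= (a i ^+ 2 + a j ^+ 2) / 2]. *)
have -> : n%:R * \sum_i a i ^+ 2 = \sum_i \sum_j (a i ^+ 2 + a j ^+ 2) / 2.
  transitivity (\sum_(i < n) \sum_(j < n) a j ^+ 2).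
    by rewrite sumr_const card_ord mulr_natl.
  under [RHS]eq_bigr do rewrite -mulr_suml big_split mulrDl /=.
  rewrite big_split /= -!mulr_suml [in X in _ = X + _]exchange_big /=.
  by rewrite -splitr.
rewrite expr2 mulr_suml; apply: ler_sum => i _.
rewrite mulr_sumr; apply: ler_sum => j _.
by have := sqr_ge0 (a i - a j); nra.
Qed.

Lemma mdist_walk (R : realFieldType) (X : metricType R) (g : nat -> X)
    (n : nat) :
  mdist (g 0) (g n) <= \sum_(k < n) mdist (g k) (g k.+1).
Proof.
elim: n => [|n IHn]; first by rewrite big_ord0 mdistxx.
rewrite big_ord_recr; apply: le_trans (metric_triangle _ (g n) _) _.
by rewrite lerD2r.
Qed.

(** * Translations and edges of the cube *)

Section cube.
Context {n : nat}.
Local Notation cube := {ffun 'I_n -> bool}.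
Implicit Types (x y z : cube) (i : 'I_n).

Lemma sum_cube_const (R : pzRingType) (c : R) : \sum_(x : cube) c = 2 ^+ n * c.
Proof. by rewrite sumr_const card_hamming_cube -[LHS]mulr_natl natrX. Qed.

(** Addition in the group [(Z/2)^n]; [flip i] adds the i-th basis vector. *)
Definition shift z x : cube := [ffun i => x i (+) z i].

Definition flip i x : cube := [ffun j => x j (+) (j == i)].

(** For [k = 0, ..., n] the points [shift (truncate k z) x] form the walk from [x] to [x + z]. *)
Definition truncate (k : nat) z : cube := [ffun i => z i && (i < k)%N].

Lemma shiftK z : involutive (shift z).
Proof. by move=> x; apply/ffunP => i; rewrite !ffunE addbK. Qed.

Lemma shiftC x z : shift z x = shift x z.
Proof. by apply/ffunP => i; rewrite !ffunE addbC. Qed.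

Lemma truncate0 z x : shift (truncate 0 z) x = x.
Proof. by apply/ffunP => i; rewrite !ffunE andbF addbF. Qed.

Lemma truncate_full z : truncate n z = z.
Proof. by apply/ffunP => i; rewrite !ffunE ltn_ord andbT. Qed.

Lemma shift_truncateS i z x :
  shift (truncate i.+1 z) x =
  if z i then flip i (shift (truncate i z) x) else shift (truncate i z) x.
Proof.
apply/ffunP => j; case: ifP => zi;
  rewrite !ffunE ltnS leq_eqVlt (inj_eq val_inj).
  have [->|_] := eqVneq j i; last by rewrite addbF.
  by rewrite zi ltnn addbF.
by have [->|//] := eqVneq j i; rewrite zi.
Qed.

Lemma flip_inj x : injective (flip ^~ x).
Proof.
move=> i j /ffunP/(_ i); rewrite !ffunE eqxx.
by case: (i =P j) => //; case: (x i).
Qed.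

(** Neighbours are parametrised by coordinates, so that sums over edges become sums over [i]. *)
Lemma hamming_cube_flip x y :
  hamming_cube n x y = (y \in [set flip i x | i : 'I_n]%SET).
Proof.
apply/cards1P/imsetP => [[i xyi]|[i _ ->]]; exists i => //.
  apply/ffunP => j; move/setP/(_ j): xyi; rewrite !inE ffunE => <-.
  by case: (x j) (y j) => [] [].
apply/setP => j; rewrite !inE ffunE.
by case: (x j) (j == i) => [] [].
Qed.

(** * Poincaré inequalities on the cube and the lower bound for the gap *)

Context {R : realType}.
Local Notation m := (@uniform_weight R _ (hamming_cube n)).

Lemma sum_neighbors x (F : cube -> R) :
  \sum_y m x y * F y = \sum_i F (flip i x).
Proof.
under eq_bigr do rewrite mulr_natl mulrb hamming_cube_flip.
rewrite -big_mkcond big_imset /=; last by move=> i j _ _ /flip_inj.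
by apply: eq_bigl => i; rewrite inE.
Qed.

Lemma weight_vertex_cube x : weight_vertex m x = n%:R.
Proof.
rewrite /weight_vertex; under eq_bigr do rewrite -[m _ _]mulr1.
by rewrite (sum_neighbors x (fun=> 1)) sumr_const card_ord.
Qed.

Lemma weight_total_cube : weight_total m = n%:R * 2 ^+ n.
Proof.
rewrite /weight_total; under eq_bigr do rewrite weight_vertex_cube.
by rewrite sum_cube_const mulrC.
Qed.

(** Every vertex has weight [n] and the total weight is [n * 2 ^+ n], nonzero for positive [n], so
    the normalisation can be cleared. *)
Lemma poincare_cubeP (X : metricType R) (C : R) : (0 < n)%N ->
  poincare m X C <->
  forall f : cube -> X,
    n%:R * \sum_x \sum_y mdist (f x) (f y) ^+ 2
    <= 2 ^+ n * C * \sum_x \sum_i mdist (f x) (f (flip i x)) ^+ 2.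
Proof.
move=> n_gt0; have n0 : 0 < n%:R :> R by rewrite ltr0n.
have n2 : 0 < 2 ^+ n :> R by rewrite exprn_gt0.
suff E (f : cube -> X) :
    ((weight_total m)^-1 * (\sum_x \sum_y
       weight_vertex m x * weight_vertex m y * mdist (f x) (f y) ^+ 2)
     <= C * \sum_x \sum_y m x y * mdist (f x) (f y) ^+ 2) =
    (n%:R * \sum_x \sum_y mdist (f x) (f y) ^+ 2
    <= 2 ^+ n * C * \sum_x \sum_i mdist (f x) (f (flip i x)) ^+ 2).
  by split=> H f; [rewrite -E|rewrite E]; exact: H.
rewrite [X in C * X](eq_bigr _ (fun x _ =>
  sum_neighbors x (fun y => mdist (f x) (f y) ^+ 2))).
have -> : \sum_x \sum_y
      weight_vertex m x * weight_vertex m y * mdist (f x) (f y) ^+ 2 =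
    n%:R ^+ 2 * \sum_x \sum_y mdist (f x) (f y) ^+ 2.
  rewrite mulr_sumr; apply: eq_bigr => x _; rewrite mulr_sumr.
  by apply: eq_bigr => y _; rewrite !weight_vertex_cube.
rewrite weight_total_cube; set S := \sum_x _; set D := \sum_x _.
rewrite -[RHS](ler_pM2l (x := (2 ^+ n)^-1)) ?invr_gt0//.
by congr (_ <= _); field; rewrite ?gt_eqF.
Qed.

Lemma sum_shift_le (X : metricType R) (f : cube -> X) z :
  \sum_x mdist (f x) (f (shift z x)) ^+ 2
  <= n%:R * \sum_x \sum_i mdist (f x) (f (flip i x)) ^+ 2.
Proof.
pose step k x :=
  mdist (f (shift (truncate k z) x)) (f (shift (truncate k.+1 z) x)).
have walk x :
    mdist (f x) (f (shift z x)) ^+ 2 <= n%:R * \sum_(k < n) step k x ^+ 2.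
  apply: le_trans (sqr_sum_le _).
  have := mdist_walk (fun k => f (shift (truncate k z) x)) n.
  rewrite truncate0 truncate_full => le_walk.
  by rewrite ler_sqr// ?nnegrE ?(le_trans _ le_walk) ?mdist_ge0.
apply: le_trans (ler_sum _ (fun x _ => walk x)) _.
rewrite -mulr_sumr ler_wpM2l// exchange_big [leRHS]exchange_big /=.
apply: ler_sum => i _.
(* Translation permutes the cube, so the edges in direction [i] may be listed from the positions
   reached after [i] steps. The next step crosses such an edge if [z i] holds and has length 0
   otherwise. *)
rewrite [leRHS](reindex_inj (inv_inj (shiftK (truncate i z)))).
apply: ler_sum => x _; rewrite /step shift_truncateS.
by case: (z i) => //; rewrite mdistxx expr0n sqr_ge0.
Qed.

Lemma poincare_sqr (X : metricType R) : (0 < n)%N -> poincare m X (n%:R ^+ 2).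
Proof.
move=> n_gt0; apply/poincare_cubeP => // f.
rewrite expr2 mulrCA -mulrA ler_pM2l ?ltr0n//.
(* Pairs [(x, y)] are reparametrised by the difference [z], with [y = x + z]. *)
have -> : \sum_x \sum_y mdist (f x) (f y) ^+ 2 =
    \sum_z \sum_x mdist (f x) (f (shift z x)) ^+ 2.
  rewrite [RHS]exchange_big; apply: eq_bigr => x _.
  rewrite (reindex_inj (inv_inj (shiftK x))).
  by apply: eq_bigr => z _; rewrite shiftC.
apply: le_trans (ler_sum _ (fun z _ => sum_shift_le f z)) _.
by rewrite sum_cube_const mulrA.
Qed.

Lemma spectral_gap_cube_ge (X : metricType R) : (0 < n)%N ->
  (exists x y : X, x <> y) -> (n%:R ^+ 2)^-1 <= spectral_gap m X.
Proof.
move=> n_gt0 [a [b ab]]; have n0 : 0 < n%:R :> R by rewrite ltr0n.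
set S : set R := [set C | 0 < C /\ poincare m X C]%classic.
have Sn : S (n%:R ^+ 2) by split; [rewrite exprn_gt0|exact: poincare_sqr].
have infn : inf S <= n%:R ^+ 2.
  by apply: ge_inf => //; exists 0 => C [/ltW].
have PI : poincare m X (inf S).
  by apply: poincare_inf; [move=> x y; exact: ler0n|exists (n%:R ^+ 2)].
(* Since [0^-1 = 0], the infimum must be shown positive before inverting. Any nonconstant map does
   this: its left-hand side is positive, which forces [inf S * D] to be positive. *)
suff inf0 : 0 < inf S by rewrite lef_pV2 ?posrE ?exprn_gt0.
pose o : cube := [ffun=> false].
pose f x := if x == o then a else b.
pose D := \sum_x \sum_i mdist (f x) (f (flip i x)) ^+ 2.
have D0 : 0 <= D by do 2 (apply: sumr_ge0 => ? _); exact: sqr_ge0.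
have S0 : 0 < \sum_x \sum_y mdist (f x) (f y) ^+ 2.
  rewrite (bigD1 o) //= (bigD1 (flip (Ordinal n_gt0) o)) //=.
  rewrite -addrA ltr_pwDl//; last first.
    rewrite addr_ge0// ?sumr_ge0// => x _; first exact: sqr_ge0.
    by apply: sumr_ge0 => y _; exact: sqr_ge0.
  rewrite exprn_gt0// mdist_gt0 /f eqxx ifN; first exact/eqP.
  by apply/eqP => /ffunP/(_ (Ordinal n_gt0)); rewrite !ffunE eqxx.
have := (poincare_cubeP X (inf S) n_gt0).1 PI f.
rewrite -/D => /(lt_le_trans (mulr_gt0 n0 S0)).
rewrite -mulrA pmulr_rgt0 ?exprn_gt0// ltNge => SD0.
by rewrite ltNge; apply: contra SD0 => infS; rewrite mulr_le0_ge0.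
Qed.

End cube.

(* [R] is a phantom parameter, needed to infer the [metricType R] instance. *)
Definition hamming_space (R : realType) (n : nat) : Type := {ffun 'I_n -> bool}.

HB.instance Definition _ (R : realType) (n : nat) :=
  Choice.on (hamming_space R n).

(** * The Hamming metric as an extremal target *)

Section hamming_metric.
Context {R : realType} {n : nat}.
Implicit Types x y z : hamming_space R n.

Definition hamming_dist x y : R := \sum_i (x i != y i)%:R.

Lemma hamming_distxx x : hamming_dist x x = 0.
Proof. by apply: big1 => i _; rewrite eqxx. Qed.

Lemma hamming_dist_eq0 x y : hamming_dist x y = 0 -> x = y.
Proof.
move=> /eqP; rewrite psumr_eq0 => [/allP xy|i _]; last exact: ler0n.
apply/ffunP => i; have := xy i (mem_index_enum _).
by rewrite /= pnatr_eq0 eqb0 negbK => /eqP.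
Qed.

Lemma hamming_distC x y : hamming_dist x y = hamming_dist y x.
Proof. by apply: eq_bigr => i _; rewrite eq_sym. Qed.

Lemma hamming_dist_triangle y x z :
  hamming_dist x z <= hamming_dist x y + hamming_dist y z.
Proof.
rewrite -big_split /=; apply: ler_sum => i _; rewrite -natrD ler_nat.
by case: (x i) (y i) (z i) => [] [] [].
Qed.

HB.instance Definition _ := isMetric.Build R (hamming_space R n)
  hamming_distxx hamming_dist_eq0 hamming_distC hamming_dist_triangle.

Lemma hamming_dist_flip i x : hamming_dist x (flip i x) = 1.
Proof.
rewrite /hamming_dist (bigD1 i) //= big1 => [|j ji]; rewrite ffunE.
  by rewrite eqxx addr0; case: (x i).
by rewrite (negbTE ji) addbF eqxx.
Qed.

(** Each coordinate of [x] disagrees with exactly one of [y] and its complement. *)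
Lemma hamming_dist_antipode x y :
  hamming_dist x y + hamming_dist x [ffun i => ~~ y i] = n%:R.
Proof.
rewrite -big_split /= (eq_bigr (fun=> 1)) ?sumr_const ?card_ord// => i _.
by rewrite ffunE; case: (x i) (y i) => [] []; rewrite ?addr0 ?add0r.
Qed.

(** Pair each [y] with its complement: if [a + b = n] then [2 * (a ^+ 2 + b ^+ 2) >= n ^+ 2]. *)
Lemma sum_sqr_hamming_dist x :
  2 ^+ n * n%:R ^+ 2
  <= 4 * \sum_(y : {ffun 'I_n -> bool}) hamming_dist x y ^+ 2.
Proof.
pose anti (y : {ffun 'I_n -> bool}) : {ffun 'I_n -> bool} := [ffun i => ~~ y i].
have antiK : involutive anti.
  by move=> y; apply/ffunP => i; rewrite !ffunE negbK.
have -> : 4 * \sum_(y : {ffun 'I_n -> bool}) hamming_dist x y ^+ 2 =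
  \sum_(y : {ffun 'I_n -> bool})
    2 * (hamming_dist x y ^+ 2 + hamming_dist x (anti y) ^+ 2).
  rewrite -mulr_sumr big_split /=.
  rewrite -(reindex_inj (inv_inj antiK)
             (P := xpredT) (F := fun y => hamming_dist x y ^+ 2)).
  by ring.
have -> : 2 ^+ n * n%:R ^+ 2 = \sum_(y : {ffun 'I_n -> bool}) n%:R ^+ 2 :> R.
  by rewrite sum_cube_const.
apply: ler_sum => y _; rewrite -(hamming_dist_antipode x y) -/(anti y).
by have := sqr_ge0 (hamming_dist x y - hamming_dist x (anti y)); nra.
Qed.

Lemma poincare_hamming_space (C : R) : (0 < n)%N ->
  poincare (uniform_weight (hamming_cube n)) (hamming_space R n) C ->
  n%:R ^+ 2 / 4 <= C.
Proof.
move=> n_gt0 /(poincare_cubeP (n := n) _ _ n_gt0)/(_ id) /=.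
have n0 : 0 < n%:R :> R by rewrite ltr0n.
have n2 : 0 < 2 ^+ n :> R by rewrite exprn_gt0.
have -> : \sum_(x : {ffun 'I_n -> bool}) \sum_i
    mdist (x : hamming_space R n) (flip i x) ^+ 2 = 2 ^+ n * n%:R.
  under eq_bigr => x _.
    under eq_bigr => i _ do rewrite [mdist _ _]hamming_dist_flip expr1n.
    rewrite sumr_const card_ord; over.
  by rewrite sum_cube_const.
have : \sum_(x : {ffun 'I_n -> bool}) 2 ^+ n * n%:R ^+ 2 <=
    \sum_(x : {ffun 'I_n -> bool}) 4 * \sum_(y : {ffun 'I_n -> bool})
      mdist (x : hamming_space R n) y ^+ 2.
  by apply: ler_sum => x _; exact: sum_sqr_hamming_dist.
rewrite -[leRHS]mulr_sumr sum_cube_const; set S := \sum_x _.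
move=> /(ler_wpM2l (ltW n0)) lb ub.
(* Scaled by [2 ^+ n * 2 ^+ n * n], the goal follows linearly from [lb] and [ub], with monomials as
   atoms. *)
rewrite ler_pdivrMr// -(ler_pM2l (mulr_gt0 (mulr_gt0 n2 n2) n0)).
by move: (2 ^+ n) (n%:R) S lb ub => P N S lb ub; lra.
Qed.

End hamming_metric.

Theorem proposition3p1 (R : realType) :
  (exists c : R, 0 < c /\
     forall (n : nat) (X : metricType R),
       (1 <= n)%N -> (exists x y : X, x <> y) ->
       spectral_gap (uniform_weight (hamming_cube n)) X >= c / n%:R ^+ 2)
  /\
  (exists C : R, 0 < C /\
     forall n : nat, (1 <= n)%N ->
       exists X : metricType R,
         (exists x y : X, x <> y) /\
         spectral_gap (uniform_weight (hamming_cube n)) X <= C / n%:R ^+ 2).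
Proof.
split.
  (* The admissible constant [n ^+ 2] yields [c = 1]; the bound [n ^+ 2 / 4] below all admissible
     constants yields [C = 4] in the second half. *)
  exists 1; split=> // n X n_gt0 X2.
  by rewrite mul1r; exact: spectral_gap_cube_ge.
exists 4; split=> // n n_gt0; exists (hamming_space R n); split.
  exists [ffun=> false], [ffun=> true] => /ffunP/(_ (Ordinal n_gt0)).
  by rewrite !ffunE.
have n0 : 0 < n%:R :> R by rewrite ltr0n.
have lb : n%:R ^+ 2 / 4 <=
    inf [set C : R | 0 < C /\ poincare (uniform_weight (hamming_cube n))
                               (hamming_space R n) C]%classic.
  (* A lower bound passes to the infimum only for a nonempty set; [n ^+ 2] is a member. *)
  apply: lb_le_inf => [|C [_]]; last exact: poincare_hamming_space.
  by exists (n%:R ^+ 2); split; [rewrite exprn_gt0|exact: poincare_sqr].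
have n4 : 0 < n%:R ^+ 2 / 4 :> R by rewrite divr_gt0 ?exprn_gt0.
by rewrite -invf_div lef_pV2 ?posrE ?(lt_le_trans n4).
Qed.
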